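(* Let $(I,\preccurlyeq)$ be a directed set, let $S(\Lambda^{\succcurlyeq})$ be a contravariant direct spectrum over $(I,\preccurlyeq)$ with sets $\lambda_0(i)$, transports $\lambda^{\succcurlyeq}_{ji}$ and Bishop spaces $\mathcal F_i=(\lambda_0(i),F_i)$, let $\mathcal F=(X,F)$ be a Bishop space, and let $S(\Lambda^{\succcurlyeq})\to\mathcal F$ be the direct spectrum over $(I,\preccurlyeq)$ with sets $\mathrm{Mor}(\mathcal F_i,\mathcal F)$, transports $(\lambda^{\succcurlyeq}_{ji})^+:\mathrm{Mor}(\mathcal F_i,\mathcal F)\to\mathrm{Mor}(\mathcal F_j,\mathcal F)$, $\phi\mapsto\phi\circ\lambda^{\succcurlyeq}_{ji}$ (for $i\preccurlyeq j$), and Bishop spaces $\mathcal F_i\to\mathcal F$. Then there is a function $\widehat{\ }:\underset{\to}{\mathrm{Lim}}\,[\mathrm{Mor}(\mathcal F_i,\mathcal F)]\to\mathrm{Mor}(\underset{\leftarrow}{\mathrm{Lim}}\,\mathcal F_i,\mathcal F)$ such that: (i) $\widehat{\ }\in\mathrm{Mor}(\underset{\to}{\mathrm{Lim}}\,(\mathcal F_i\to\mathcal F),(\underset{\leftarrow}{\mathrm{Lim}}\,\mathcal F_i)\to\mathcal F)$; (ii) if for every $j\in I$ and every $y\in\lambda_0(j)$ there is $\Theta_y\in\prod^{\succcurlyeq}_{i\in I}\lambda_0(i)$ with $\Theta_y(j)=y$ in $\lambda_0(j)$, then $\widehat{\ }$ is an embedding.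
   Context: Work in Bishop-style constructive mathematics. Each set has its own equality; functions respect it; an embedding $f$ satisfies $f(x)=f(x')\Rightarrow x=x'$. A directed set: a set with a reflexive transitive relation respecting equality, any two elements having a common upper bound. A direct family over $(I,\preccurlyeq)$: sets $\mu_0(i)$ and functions $\mu^{\preccurlyeq}_{ij}:\mu_0(i)\to\mu_0(j)$ for $i\preccurlyeq j$ with $\mu^{\preccurlyeq}_{ii}=\mathrm{id}$, $\mu^{\preccurlyeq}_{ik}=\mu^{\preccurlyeq}_{jk}\circ\mu^{\preccurlyeq}_{ij}$. A contravariant direct family: sets $\lambda_0(i)$ and functions $\lambda^{\succcurlyeq}_{ji}:\lambda_0(j)\to\lambda_0(i)$ for $i\preccurlyeq j$ with $\lambda^{\succcurlyeq}_{ii}=\mathrm{id}$, $\lambda^{\succcurlyeq}_{ki}=\lambda^{\succcurlyeq}_{ji}\circ\lambda^{\succcurlyeq}_{kj}$. Bishop spaces: a Bishop topology on $X$ is a set $F$ of functions $X\to\mathbb R$ containing constants, closed under addition, composition with functions $\mathbb R\to\mathbb R$ uniformly continuous on every $[-n,n]$, and uniform limits; $\bigvee F_0$ = least Bishop topology containing $F_0$; Bishop morphism $(X,F)\to(Y,G)$: function $h$ with $g\circ h\in F$ for all $g\in G$. Exponential: $\mathcal F\to\mathcal G=(\mathrm{Mor}(\mathcal F,\mathcal G),\bigvee\{\phi_{x,g}\})$, $\phi_{x,g}(h)=g(h(x))$. A (contravariant) direct spectrum: a (contravariant) direct family with Bishop topologies making all transports Bishop morphisms. Direct limit of a direct spectrum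 (sets $\mu_0(i)$, transports $\mu^{\preccurlyeq}_{ij}$, topologies $G_i$): pairs $(i,x)$ with $(i,x)=(j,y)$ iff there is $k\succcurlyeq i,j$ with $\mu^{\preccurlyeq}_{ik}(x)=\mu^{\preccurlyeq}_{jk}(y)$; $\underset{\to}{\mathrm{Lim}}\,\mu_0(i)$ = classes $\mathrm{eql}_0(i,x)$; $\prod^{\succcurlyeq}G_i$ = dependent $\Theta$ with $\Theta_i\in G_i$, $\Theta_i=\Theta_j\circ\mu^{\preccurlyeq}_{ij}$; $\underset{\to}{\mathrm{Lim}}\,\mathcal G_i=(\underset{\to}{\mathrm{Lim}}\,\mu_0(i),\bigvee\{\mathrm{eql}_0f_\Theta\})$ with $\mathrm{eql}_0f_\Theta(\mathrm{eql}_0(i,x))=\Theta_i(x)$. Inverse limit of the contravariant spectrum: $\prod^{\succcurlyeq}\lambda_0(i)$ = dependent $\Phi$ with $\Phi_i\in\lambda_0(i)$, $\Phi_i=\lambda^{\succcurlyeq}_{ji}(\Phi_j)$ for $i\preccurlyeq j$; $\pi_i(\Phi)=\Phi_i$; $\underset{\leftarrow}{\mathrm{Lim}}\,\mathcal F_i=(\prod^{\succcurlyeq}\lambda_0(i),\bigvee\{f\circ\pi_i:i\in I,f\in F_i\})$. *)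

(* Defs.v *)
From Stdlib Require Import Reals Lra RelationClasses Setoid Morphisms.
Open Scope R_scope.

Record Setoid := { car :> Type; eqv : car -> car -> Prop; eqv_equiv : Equivalence eqv }.
Arguments eqv {s} _ _.
#[global] Existing Instance eqv_equiv.
Notation "x =s= y" := (eqv x y) (at level 70, no associativity).

Record Fun (X Y : Setoid) := { fmap :> X -> Y;
  fresp : forall x x', x =s= x' -> fmap x =s= fmap x' }.
Arguments fmap {X Y} _ _.
Arguments fresp {X Y} _ _ _ _.

Definition Embedding {X Y : Setoid} (f : Fun X Y) : Prop :=
  forall x x', f x =s= f x' -> x =s= x'.

Definition Bcont (phi : R -> R) : Prop :=
  forall n : nat, forall eps, 0 < eps -> exists delta, 0 < delta /\
    forall x y, Rabs x <= INR n -> Rabs y <= INR n -> Rabs (x - y) < delta ->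
      Rabs (phi x - phi y) < eps.

Definition extensional (X : Setoid) (f : X -> R) : Prop :=
  forall x x', x =s= x' -> f x = f x'.

Record BishopTop (X : Setoid) (F : (X -> R) -> Prop) : Prop := {
  bt_ext : forall f, F f -> extensional X f;
  bt_const : forall a : R, F (fun _ => a);
  bt_add : forall f g, F f -> F g -> F (fun x => f x + g x);
  bt_comp : forall f phi, F f -> Bcont phi -> F (fun x => phi (f x));
  bt_lim : forall f, extensional X f ->
    (forall eps, 0 < eps -> exists g, F g /\ forall x, Rabs (g x - f x) <= eps) -> F f }.

Definition bigvee (X : Setoid) (F0 : (X -> R) -> Prop) : (X -> R) -> Prop :=
  fun f => forall G, BishopTop X G -> (forall g, F0 g -> G g) -> G f.

Lemma extensional_top (X : Setoid) : BishopTop X (extensional X).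
Proof.
  split.
  - auto.
  - intros a x x' _; reflexivity.
  - intros f g Hf Hg x x' H; rewrite (Hf x x' H), (Hg x x' H); reflexivity.
  - intros f phi Hf _ x x' H; rewrite (Hf x x' H); reflexivity.
  - auto.
Qed.

Lemma bigvee_top (X : Setoid) (F0 : (X -> R) -> Prop) :
  (forall f, F0 f -> extensional X f) -> BishopTop X (bigvee X F0).
Proof.
  intros H0; split.
  - intros f Hf; exact (Hf _ (extensional_top X) H0).
  - intros a G HG _; apply (bt_const _ _ HG).
  - intros f g Hf Hg G HG HF; apply (bt_add _ _ HG); [exact (Hf G HG HF) | exact (Hg G HG HF)].
  - intros f phi Hf Hphi G HG HF; apply (bt_comp _ _ HG); [exact (Hf G HG HF) | exact Hphi].
  - intros f Hext Hlim G HG HF; apply (bt_lim _ _ HG); [exact Hext|].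
    intros eps Heps; destruct (Hlim eps Heps) as [g [Hg Hgf]].
    exists g; split; [exact (Hg G HG HF) | exact Hgf].
Qed.

Record BSpace := { bs :> Setoid; top : (bs -> R) -> Prop; top_ok : BishopTop bs top }.

Definition IsMor (A B : BSpace) (h : Fun A B) : Prop :=
  forall g, top B g -> top A (fun x => g (h x)).

Record Mor (A B : BSpace) := { mfun :> Fun A B; mor_ok : IsMor A B mfun }.
Arguments mfun {A B} _.

Definition MorS (A B : BSpace) : Setoid.
Proof.
  refine {| car := Mor A B; eqv := fun h h' => forall x, h x =s= h' x |}.
  split.
  - intros h x; reflexivity.
  - intros h h' H x; symmetry; auto.
  - intros h h' h'' H H' x; transitivity (h' x); auto.
Defined.

Definition exp_gen (A B : BSpace) : (MorS A B -> R) -> Prop :=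
  fun f => exists (x : A) (g : B -> R), top B g /\ f = (fun h : MorS A B => g (h x)).

Lemma exp_gen_ext A B : forall f, exp_gen A B f -> extensional (MorS A B) f.
Proof.
  intros f [x [g [Hg ->]]] h h' H.
  apply (bt_ext _ _ (top_ok B) g Hg); apply H.
Qed.

Definition Exp (A B : BSpace) : BSpace :=
  {| bs := MorS A B; top := bigvee (MorS A B) (exp_gen A B);
     top_ok := bigvee_top _ _ (exp_gen_ext A B) |}.

Record DirSet := { ds :> Setoid; le : ds -> ds -> Prop;
  le_resp : forall i i' j j', i =s= i' -> j =s= j' -> le i j -> le i' j';
  le_refl : forall i, le i i;
  le_trans : forall i j k, le i j -> le j k -> le i k;
  le_dir : forall i j, exists k, le i k /\ le j k }.
Arguments le {d} _ _.

Record DirFam (I : DirSet) := {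
  mu0 : I -> BSpace;
  mu : forall i j, le i j -> Fun (mu0 i) (mu0 j);
  mu_id : forall i (p : le i i) x, mu i i p x =s= x;
  mu_comp : forall i j k (p : le i j) (q : le j k) (r : le i k) x,
      mu i k r x =s= mu j k q (mu i j p x) }.
Arguments mu0 {I} _ _.
Arguments mu {I} _ _ _ _.

Record ContraSpec (I : DirSet) := {
  lam0 : I -> BSpace;
  lam : forall i j, le i j -> Fun (lam0 j) (lam0 i);
  lam_id : forall i (p : le i i) x, lam i i p x =s= x;
  lam_comp : forall i j k (p : le i j) (q : le j k) (r : le i k) x,
      lam i k r x =s= lam i j p (lam j k q x);
  lam_mor : forall i j (p : le i j), IsMor (lam0 j) (lam0 i) (lam i j p) }.
Arguments lam0 {I} _ _.
Arguments lam {I} _ _ _ _.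

Section DirLimit.
Variables (I : DirSet) (M : DirFam I).

Definition dl_eq (a b : {i : I & mu0 M i}) : Prop :=
  exists k (p : le (projT1 a) k) (q : le (projT1 b) k),
    mu M _ k p (projT2 a) =s= mu M _ k q (projT2 b).

Lemma dl_equiv : Equivalence dl_eq.
Proof.
  split.
  - intros [i x]; exists i, (le_refl I i), (le_refl I i); reflexivity.
  - intros [i x] [j y] [k [p [q H]]]; exists k, q, p; symmetry; exact H.
  - intros [i x] [j y] [l z] [k [p [q H]]] [m [p' [q' H']]]; simpl in *.
    destruct (le_dir I k m) as [n [hk hm]].
    exists n, (le_trans I _ _ _ p hk), (le_trans I _ _ _ q' hm); simpl.
    rewrite (mu_comp _ M _ _ _ p hk).
    rewrite (fresp (mu M k n hk) _ _ H).
    rewrite <- (mu_comp _ M _ _ _ q hk (le_trans I _ _ _ q hk)).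
    rewrite (mu_comp _ M _ _ _ p' hm).
    rewrite (fresp (mu M m n hm) _ _ H').
    rewrite <- (mu_comp _ M _ _ _ q' hm).
    reflexivity.
Qed.

Definition DirLimS : Setoid :=
  {| car := {i : I & mu0 M i}; eqv := dl_eq; eqv_equiv := dl_equiv |}.

Definition dl_gen : (DirLimS -> R) -> Prop :=
  fun f => exists Theta : forall i, mu0 M i -> R,
    (forall i, top (mu0 M i) (Theta i)) /\
    (forall i j (p : le i j) x, Theta i x = Theta j (mu M i j p x)) /\
    f = (fun a : DirLimS => Theta (projT1 a) (projT2 a)).

Lemma dl_gen_ext : forall f, dl_gen f -> extensional DirLimS f.
Proof.
  intros f [Th [HT [Hc ->]]] [i x] [j y] [k [p [q H]]]; simpl in *.
  rewrite (Hc i k p x), (Hc j k q y).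
  apply (bt_ext _ _ (top_ok (mu0 M k)) _ (HT k)); exact H.
Qed.

Definition DirLim : BSpace :=
  {| bs := DirLimS; top := bigvee DirLimS dl_gen; top_ok := bigvee_top _ _ dl_gen_ext |}.
End DirLimit.

Section InvLimit.
Variables (I : DirSet) (L : ContraSpec I).

Definition InvLimCar : Type :=
  {Phi : forall i, lam0 L i | forall i j (p : le i j), Phi i =s= lam L i j p (Phi j)}.

Definition InvLimS : Setoid.
Proof.
  refine {| car := InvLimCar;
            eqv := fun Phi Psi => forall i, proj1_sig Phi i =s= proj1_sig Psi i |}.
  split.
  - intros P i; reflexivity.
  - intros P Q H i; symmetry; auto.
  - intros P Q U H H' i; transitivity (proj1_sig Q i); auto.
Defined.

Definition il_gen : (InvLimS -> R) -> Prop :=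
  fun f => exists i (g : lam0 L i -> R), top (lam0 L i) g /\
    f = (fun Phi : InvLimS => g (proj1_sig Phi i)).

Lemma il_gen_ext : forall f, il_gen f -> extensional InvLimS f.
Proof.
  intros f [i [g [Hg ->]]] P Q H.
  apply (bt_ext _ _ (top_ok (lam0 L i)) g Hg); apply H.
Qed.

Definition InvLim : BSpace :=
  {| bs := InvLimS; top := bigvee InvLimS il_gen; top_ok := bigvee_top _ _ il_gen_ext |}.
End InvLimit.

Section ToF.
Variables (I : DirSet) (L : ContraSpec I) (F : BSpace).

Definition precomp_fun i j (p : le i j) (phi : Mor (lam0 L i) F) : Fun (lam0 L j) F :=
  {| fmap := fun y => phi (lam L i j p y);
     fresp := fun y y' H => fresp phi _ _ (fresp (lam L i j p) _ _ H) |}.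

Lemma precomp_mor i j (p : le i j) (phi : Mor (lam0 L i) F) :
  IsMor (lam0 L j) F (precomp_fun i j p phi).
Proof.
  intros g Hg; simpl.
  apply (lam_mor _ L i j p (fun x => g (phi x))).
  apply (mor_ok _ _ phi); exact Hg.
Qed.

Definition precomp i j (p : le i j) (phi : Mor (lam0 L i) F) : Mor (lam0 L j) F :=
  {| mfun := precomp_fun i j p phi; mor_ok := precomp_mor i j p phi |}.

Definition plus_tr i j (p : le i j) : Fun (Exp (lam0 L i) F) (Exp (lam0 L j) F).
Proof.
  refine (@Build_Fun (Exp (lam0 L i) F) (Exp (lam0 L j) F) (precomp i j p) _).
  intros phi phi' H y; simpl; apply H.
Defined.

Definition ToFam : DirFam I.
Proof.
  refine {| mu0 := fun i => Exp (lam0 L i) F; mu := plus_tr |}.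
  - intros i p phi y; simpl.
    apply (fresp phi); apply (lam_id _ L).
  - intros i j k p q r phi y; simpl.
    apply (fresp phi); apply (lam_comp _ L).
Defined.
End ToF.

(* Main.v *)
(* The map sends the class of [(i, phi)], with [phi] a morphism on the i-th
   space, to [phi o pi_i] on the inverse limit; compatible threads make it
   independent of the representative.  It is a Bishop morphism because the
   topology of the exponential is generated by the evaluations [phi_{Phi,g}],
   and the pullback of each of them along the map is the generator [eql0 f_Theta]
   of the direct-limit topology with [Theta_i(phi) = g (phi (Phi_i))].  If every
   point of every [lambda_0(k)] lies on a thread, two representatives with equal
   images agree after transport to a common upper bound [k], hence are equal. *)
Require Import Defs.
From Stdlib Require Import Reals Setoid.
Open Scope R_scope.

Definition comp_fun {A B C : Setoid} (g : Fun B C) (f : Fun A B) : Fun A C :=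
  {| fmap := fun x => g (f x); fresp := fun x x' H => fresp g _ _ (fresp f _ _ H) |}.

Lemma comp_mor_ok (A B C : BSpace) (g : Mor B C) (f : Mor A B) :
  IsMor A C (comp_fun g f).
Proof.
  intros h Hh; apply (mor_ok _ _ f (fun y => h (g y))), (mor_ok _ _ g), Hh.
Qed.

Definition comp_mor {A B C : BSpace} (g : Mor B C) (f : Mor A B) : Mor A C :=
  {| mfun := comp_fun g f; mor_ok := comp_mor_ok A B C g f |}.

Lemma bigvee_gen (X : Setoid) (F0 : (X -> R) -> Prop) f : F0 f -> bigvee X F0 f.
Proof. intros Hf G _ HG; exact (HG f Hf). Qed.

Definition pullback_top (A : BSpace) (Y : Setoid) (h : Fun A Y) : (Y -> R) -> Prop :=
  fun f => extensional Y f /\ top A (fun x => f (h x)).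

Lemma pullback_top_ok (A : BSpace) (Y : Setoid) (h : Fun A Y) :
  BishopTop Y (pullback_top A Y h).
Proof.
  pose proof (extensional_top Y) as EY; pose proof (top_ok A) as TA.
  split.
  - intros f [Hf _]; exact Hf.
  - intros a; split; [apply (bt_const _ _ EY) | apply (bt_const _ _ TA)].
  - intros f g [Hf1 Hf2] [Hg1 Hg2]; split;
      [apply (bt_add _ _ EY) | apply (bt_add _ _ TA)]; assumption.
  - intros f phi [Hf1 Hf2] Hphi; split;
      [apply (bt_comp _ _ EY) | apply (bt_comp _ _ TA)]; assumption.
  - intros f Hext Hlim; split; [exact Hext|].
    apply (bt_lim _ _ TA).
    + intros x x' Hx; apply Hext, (fresp h), Hx.
    + intros eps Heps; destruct (Hlim eps Heps) as [g [[_ Hg] Hgf]].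
      exists (fun x => g (h x)); split; [exact Hg | intros x; apply Hgf].
Qed.

Lemma bigvee_precomp (A : BSpace) (Y : Setoid) (F0 : (Y -> R) -> Prop) (h : Fun A Y) :
  (forall g, F0 g -> extensional Y g) ->
  (forall g, F0 g -> top A (fun x => g (h x))) ->
  forall f, bigvee Y F0 f -> top A (fun x => f (h x)).
Proof.
  intros Hext Hgen f Hf.
  apply (Hf _ (pullback_top_ok A Y h)).
  intros g Hg; split; [apply Hext | apply Hgen]; exact Hg.
Qed.

Section InverseLimit.
Variables (I : DirSet) (L : ContraSpec I).

Definition proj_fun (i : I) : Fun (InvLim I L) (lam0 L i) :=
  {| fmap := fun Phi : InvLimS I L => proj1_sig Phi i; fresp := fun _ _ H => H i |}.

Lemma proj_mor_ok (i : I) : IsMor (InvLim I L) (lam0 L i) (proj_fun i).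
Proof. intros g Hg; apply bigvee_gen; exists i, g; split; [exact Hg | reflexivity]. Qed.

Definition proj_mor (i : I) : Mor (InvLim I L) (lam0 L i) :=
  {| mfun := proj_fun i; mor_ok := proj_mor_ok i |}.

Lemma thread_transport (Phi : InvLimS I L) i k (p : le i k) y :
  proj1_sig Phi k =s= y -> proj1_sig Phi i =s= lam L i k p y.
Proof.
  intros Hy; rewrite (proj2_sig Phi i k p); apply (fresp (lam L i k p)), Hy.
Qed.

End InverseLimit.

Section Hat.
Variables (I : DirSet) (L : ContraSpec I) (F : BSpace).

Let D := DirLim I (ToFam I L F).
Let E := Exp (InvLim I L) F.

Definition hat_map (a : D) : E :=
  comp_mor (projT2 a : Mor (lam0 L (projT1 a)) F) (proj_mor I L (projT1 a)).

Lemma hat_map_resp a b : a =s= b -> hat_map a =s= hat_map b.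
Proof.
  destruct a as [i phi], b as [j psi]; intros [k [p [q H]]] Phi; simpl in *.
  rewrite (fresp phi _ _ (proj2_sig Phi i k p)), (fresp psi _ _ (proj2_sig Phi j k q)).
  exact (H (proj1_sig Phi k)).
Qed.

Definition hat : Fun D E := {| fmap := hat_map; fresp := hat_map_resp |}.

Lemma hat_mor : IsMor D E hat.
Proof.
  intros f; apply bigvee_precomp; [apply exp_gen_ext|].
  intros f' [Phi [g [Hg ->]]]; apply bigvee_gen.
  exists (fun i (phi : Mor (lam0 L i) F) => g (phi (proj1_sig Phi i))).
  split; [|split; [|reflexivity]].
  - intros i; apply bigvee_gen; exists (proj1_sig Phi i), g; split; [exact Hg | reflexivity].
  - intros i j p phi; simpl.
    apply (bt_ext _ _ (top_ok F) g Hg), (fresp phi), (proj2_sig Phi).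
Qed.

Lemma hat_embedding :
  (forall (j : I) (y : lam0 L j), exists Phi : InvLimS I L, proj1_sig Phi j =s= y) ->
  Embedding hat.
Proof.
  intros Hthread [i phi] [j psi] Heq.
  destruct (le_dir I i j) as [k [p q]].
  exists k, p, q; intros y; simpl.
  destruct (Hthread k y) as [Phi Hy].
  rewrite <- (fresp phi _ _ (thread_transport I L Phi i k p y Hy)).
  rewrite <- (fresp psi _ _ (thread_transport I L Phi j k q y Hy)).
  exact (Heq Phi).
Qed.

End Hat.

Theorem proposition11p4 (I : DirSet) (L : ContraSpec I) (F : BSpace) :
  exists hat : Fun (DirLim I (ToFam I L F)) (Exp (InvLim I L) F),
    IsMor (DirLim I (ToFam I L F)) (Exp (InvLim I L) F) hat /\
    ((forall (j : I) (y : lam0 L j),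
        exists Theta : InvLimS I L, proj1_sig Theta j =s= y) ->
     Embedding hat).
Proof.
  exists (hat I L F); split; [apply hat_mor | apply hat_embedding].
Qed.
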